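(* Let $f$ be a function in a disk $D\subset\mathbb{R}^2$ which is of class $C^n$ whenever contact of order $n$ is considered below ($n=2,3,4$). Let $a,b,u,v,x,y,z\in\mathbb{R}$ with $(x,y)\in D$, $(u,v)\ne(0,0)$, and consider the conic parametrized by $$x(t)=x+v\sin t+u(1-\cos t),\quad y(t)=y-u\sin t+v(1-\cos t),\quad z(t)=z+a\sin t+b(1-\cos t).$$ All derivatives of $f$ below are evaluated at $(x,y)$. The conic has contact of order $2$ with the graph of $f$ (at $t=0$) if and only if $$\begin{cases} z=f(x,y),\\ a=f_xv-f_yu,\\ b=f_xu+f_yv+f_{xx}v^2-2f_{xy}uv+f_{yy}u^2.\end{cases}$$ The contact order is $3$ if and only if in addition $$f_{xxx}v^3-3f_{xxy}v^2u+3f_{xyy}vu^2-f_{yyy}u^3+3(f_{xx}-f_{yy})uv+3f_{xy}(v^2-u^2)=0.$$ The contact order is $4$ if and only if in addition (to all the previous equations) $$\begin{aligned}&f_{xxxx}v^4-4f_{xxxy}v^3u+6f_{xxyy}v^2u^2-4f_{xyyy}vu^3+f_{yyyy}u^4\\&+6uv^2f_{xxx}+6v(v^2-2u^2)f_{xxy}+6u(u^2-2v^2)f_{xyy}+6u^2vf_{yyy}\\&+3(u^2-v^2)(f_{xx}-f_{yy})+12uvf_{xy}=0.\end{aligned}$$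
   Context: Let $f$ be a $C^n$ function in a disk $D\subset\mathbb{R}^2$ and let $(x(t),y(t),z(t))$, $t$ in an interval $I$, be a $C^n$ curve with $(\dot x(t),\dot y(t))\ne 0$ for each $t\in I$. The curve has contact of order $n$ with the graph of $f$ at $t=0$ if $\frac{z(t)-f(x(t),y(t))}{t^n}\to0$ as $t\to0$. ''The contact order is $n$'' means that the curve has contact of order $n$ in this sense (higher order contact is not excluded). *)

(* Defs.v *)
From Stdlib Require Import Reals Lra.
From Coquelicot Require Import Coquelicot.
Open Scope R_scope.

(** A function on a disk [D] is represented by a total function [R -> R -> R]
    whose values outside [D] are arbitrary: as [D] is open, neither the partial
    derivatives at points of [D] nor limits at points of [D] depend on them. *)

Definition disk (cx cy r X Y : R) : Prop := (X - cx) ^ 2 + (Y - cy) ^ 2 < r ^ 2.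

(** [ex_diff_n f n p q] says that at [(p, q)] all iterated partial derivatives
    of [f] of order at most [n], in every order of differentiation, exist and
    are continuous. *)
Definition class_Cn_on (D : R -> R -> Prop) (n : nat) (f : R -> R -> R) : Prop :=
  forall p q : R, D p q -> ex_diff_n f n p q.

(** Contact of order (at least) [n] at [t = 0] of the curve
    [t |-> (X t, Y t, Z t)] with the graph of [f]. The limit in [is_lim] is the
    punctured one, so the value of the quotient at [t = 0] is irrelevant. *)
Definition has_contact (n : nat) (f : R -> R -> R) (X Y Z : R -> R) : Prop :=
  is_lim (fun t : R => (Z t - f (X t) (Y t)) / t ^ n) 0 0.

Definition conic_x (u v x t : R) : R := x + v * sin t + u * (1 - cos t).
Definition conic_y (u v y t : R) : R := y - u * sin t + v * (1 - cos t).
Definition conic_z (a b z t : R) : R := z + a * sin t + b * (1 - cos t).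

(** The planar projection of the conic is a regular curve when [(u, v)] is not
    [(0, 0)], as is required of the curves whose contact is considered. *)
Lemma conic_velocity_neq0 (u v x y t : R) :
  (u, v) <> (0, 0) ->
  (Derive (conic_x u v x) t, Derive (conic_y u v y) t) <> (0, 0).
Proof.
intros Huv H; apply Huv.
assert (HX : Derive (conic_x u v x) t = v * cos t + u * sin t).
{ apply is_derive_unique; unfold conic_x; auto_derive; [easy | ring]. }
assert (HY : Derive (conic_y u v y) t = - u * cos t + v * sin t).
{ apply is_derive_unique; unfold conic_y; auto_derive; [easy | ring]. }
rewrite HX, HY in H; injection H as H1 H2.
pose proof (sin2_cos2 t) as Hsc; unfold Rsqr in Hsc.
f_equal.
- replace u with (u * (sin t * sin t + cos t * cos t)) by (rewrite Hsc; ring).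
  replace (u * _) with (sin t * (v * cos t + u * sin t)
                        - cos t * (- u * cos t + v * sin t)) by ring.
  rewrite H1, H2; ring.
- replace v with (v * (sin t * sin t + cos t * cos t)) by (rewrite Hsc; ring).
  replace (v * _) with (cos t * (v * cos t + u * sin t)
                        + sin t * (- u * cos t + v * sin t)) by ring.
  rewrite H1, H2; ring.
Qed.

(* Main.v *)
Require Import Defs.
From Stdlib Require Import Factorial Reals Lra Lia.
From Coquelicot Require Import Coquelicot.
Open Scope R_scope.

(** Along the curve the function [t |-> z(t) - f(x(t), y(t))] is [C^n], so by
    the Taylor-Young expansion it is [o(t^n)] exactly when its derivatives of
    order at most [n] vanish at [0]. The velocity [(p, q)] of the circle
    [(x(t), y(t))] satisfies [p' = - q] and [q' = p], hence iterating the chain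
    rule produces polynomials in [p], [q] and the partial derivatives of [f];
    at [t = 0] one has [(p, q) = (v, - u)]. *)

(** * Taylor-Young expansion at [0] and flatness to order [n] *)

(** By the mean value theorem the difference [H] of [F] and its expected leading term satisfies
    [H t = H' c * t] with [Rabs c <= Rabs t]. The bound on [dF] at [c] thus gains one factor
    [Rabs t]. *)
Lemma primitive_expansion (F dF : R -> R) (n : nat) (l : R) :
  locally 0 (fun t => is_derive F t (dF t)) ->
  F 0 = 0 ->
  (forall eps : posreal,
     locally 0 (fun t => Rabs (dF t - l * t ^ n) <= eps * Rabs t ^ n)) ->
  forall eps : posreal,
    locally 0 (fun t =>
      Rabs (F t - l / INR (S n) * t ^ S n) <= eps * Rabs t ^ S n).
Proof.
intros [d1 HF] F0 HdF eps.
destruct (HdF eps) as [d2 Hd].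
assert (Hd0 : 0 < Rmin d1 d2) by (apply Rmin_glb_lt; apply cond_pos).
exists (mkposreal _ Hd0); intros t Ht.
change (Rabs (t - 0) < Rmin d1 d2) in Ht.
set (H := fun s => F s - l / INR (S n) * s ^ S n).
assert (Hball : forall c, Rabs c <= Rabs t -> ball 0 d1 c /\ ball 0 d2 c).
{ intros c Hc; rewrite Rminus_0_r in Ht.
  pose proof (Rmin_l d1 d2); pose proof (Rmin_r d1 d2).
  split; [change (Rabs (c - 0) < d1) | change (Rabs (c - 0) < d2)];
    rewrite Rminus_0_r; lra. }
destruct (MVT_cor4 H (fun s => dF s - l * s ^ n) 0 (Rabs t)) with (b := t)
  as [c [E Hc]].
- intros c Hc; rewrite Rminus_0_r in Hc.
  pose proof (HF c (proj1 (Hball c Hc))) as D.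
  unfold H; auto_derive.
  + eexists; exact D.
  + replace (Derive (fun x => F x) c) with (dF c)
      by (symmetry; now apply is_derive_unique).
    (* The [match] is [INR (S n)] as unfolded by [auto_derive]. *)
    change (match n with 0%nat => 1 | S _ => INR n + 1 end) with (INR (S n)).
    field; apply not_0_INR; discriminate.
- rewrite Rminus_0_r; lra.
- rewrite !Rminus_0_r in *.
  assert (E' : H t = (dF c - l * c ^ n) * t).
  { rewrite <- E; unfold H; rewrite F0; simpl; ring. }
  change (Rabs (H t) <= eps * Rabs t ^ S n).
  rewrite E', Rabs_mult; simpl.
  replace (eps * (Rabs t * Rabs t ^ n)) with (eps * Rabs t ^ n * Rabs t) by ring.
  apply Rmult_le_compat_r; [apply Rabs_pos |].
  apply Rle_trans with (1 := Hd c (proj2 (Hball c Hc))).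
  apply Rmult_le_compat_l; [apply Rlt_le, cond_pos |].
  apply pow_incr; split; [apply Rabs_pos | exact Hc].
Qed.

(** Induction on [n] through the shifted family [d (S k)]: passing to a primitive divides the
    leading coefficient by [S n], which turns [fact n] into [fact (S n)]. The base case is the
    continuity of the top derivative at [0]. *)
Lemma taylor_young_leading (n : nat) (d : nat -> R -> R) :
  (forall k, (k < n)%nat ->
     locally 0 (fun t => is_derive (d k) t (d (S k) t))) ->
  continuous (d n) 0 ->
  (forall k, (k < n)%nat -> d k 0 = 0) ->
  forall eps : posreal,
    locally 0 (fun t =>
      Rabs (d 0%nat t - d n 0 / INR (fact n) * t ^ n) <= eps * Rabs t ^ n).
Proof.
revert d; induction n as [|n IH]; intros d Hd Hc H0 eps.
- destruct (proj1 (filterlim_locally _ _) Hc eps) as [e He].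
  exists e; intros t Ht; apply Rlt_le.
  replace (_ - _) with (d 0%nat t - d 0%nat 0) by (simpl; field).
  rewrite Rmult_1_r; exact (He t Ht).
- replace (d (S n) 0 / INR (fact (S n)))
    with (d (S n) 0 / INR (fact n) / INR (S n))
    by (rewrite fact_simpl, mult_INR; field;
        split; [apply INR_fact_neq_0 | apply not_0_INR; discriminate]).
  apply primitive_expansion with (dF := d 1%nat).
  + apply Hd; lia.
  + apply H0; lia.
  + apply (IH (fun k => d (S k))); [intros k Hk; apply Hd; lia | exact Hc |].
    intros k Hk; apply H0; lia.
Qed.

Lemma is_lim_of_expansion (g : R -> R) (n : nat) (l : R) :
  (forall eps : posreal,
     locally 0 (fun t => Rabs (g t - l * t ^ n) <= eps * Rabs t ^ n)) ->
  is_lim (fun t => g t / t ^ n) 0 l.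
Proof.
intros H; apply is_lim_spec; intros eps.
(* The expansion bounds weakly while the limit asks for a strict inequality, hence half of [eps]. *)
destruct (H (pos_div_2 eps)) as [d Hd].
exists d; intros t Ht Hn.
assert (Hp : t ^ n <> 0) by now apply pow_nonzero.
replace (g t / t ^ n - l) with ((g t - l * t ^ n) / t ^ n) by now field.
rewrite Rabs_div, <- RPow_abs by assumption.
assert (P : 0 < Rabs t ^ n) by now apply pow_lt, Rabs_pos_lt.
apply Rlt_div_l; [exact P |].
apply Rle_lt_trans with (1 := Hd t Ht).
apply Rmult_lt_compat_r; [exact P |].
destruct eps as [e He]; simpl; lra.
Qed.

(** A function that is [o(t^(n+1))] is also [o(t^n)], so by induction the lower derivatives vanish.
    The quotient then tends to the leading Taylor coefficient, which uniqueness of limits forces to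
    be [0]. The converse is the expansion itself. *)
Lemma little_o_pow_iff (n : nat) (d : nat -> R -> R) :
  (forall k, (k < n)%nat ->
     locally 0 (fun t => is_derive (d k) t (d (S k) t))) ->
  continuous (d n) 0 ->
  is_lim (fun t => d 0%nat t / t ^ n) 0 0 <->
  forall k, (k <= n)%nat -> d k 0 = 0.
Proof.
intros Hd Hc; split.
- revert Hd Hc; induction n as [|n IH]; intros Hd Hc L k Hk.
  + replace k with 0%nat by lia.
    pose proof (is_lim_of_expansion _ 0 _
      (taylor_young_leading 0 d Hd Hc ltac:(lia))) as L'.
    apply is_lim_unique in L, L'; rewrite L in L'.
    injection L' as E; simpl in E; lra.
  + assert (B : forall j, (j < S n)%nat -> d j 0 = 0).
    (* The quotient by [t ^ n] is [t] times the quotient by [t ^ S n]. *)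
    { assert (Ln : is_lim (fun t => d 0%nat t / t ^ n) 0 0).
      { apply is_lim_ext_loc with (fun t => t * (d 0%nat t / t ^ S n)).
        - exists (mkposreal 1 Rlt_0_1); intros t _ Ht; simpl; field.
          now split; [apply pow_nonzero |].
        - pose proof (is_lim_mult (fun t => t) _ 0 0 0 (is_lim_id 0) L I) as M.
          simpl Rbar_mult in M; rewrite Rmult_0_l in M; exact M. }
      intros j Hj; apply IH; [| | exact Ln | lia].
      - intros i Hi; apply Hd; lia.
      - apply (ex_derive_continuous (d n)); eexists.
        exact (locally_singleton _ _ (Hd n ltac:(lia))). }
    destruct (Nat.eq_dec k (S n)) as [-> | Hne]; [| apply B; lia].
    pose proof (is_lim_of_expansion _ (S n) _
      (taylor_young_leading (S n) d Hd Hc B)) as L'.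
    apply is_lim_unique in L, L'; rewrite L in L'.
    injection L' as E; symmetry in E.
    apply (Rmult_eq_reg_r (/ INR (fact (S n)))).
    * rewrite Rmult_0_l; exact E.
    * apply Rinv_neq_0_compat, INR_fact_neq_0.
- intros H0.
  (* The second [0] is the value of the limit; the first is the point. *)
  replace 0 with (d n 0 / INR (fact n)) at 2
    by (rewrite H0 by lia; field; apply INR_fact_neq_0).
  apply is_lim_of_expansion, taylor_young_leading; auto with arith.
Qed.

(** * Regularity of the partial derivatives, and openness of the disk *)

(** Differentiability follows from a derivative in [x] that exists nearby and is continuous at the
    point, together with a derivative in [y] at the point. *)
Lemma partial_derive_differentiable (f : R -> R -> R) (n i j : nat) (x y : R) :
  (i + j < n)%nat ->
  locally_2d (ex_diff_n f n) x y ->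
  differentiable_pt_lim (partial_derive i j f) x y
    (partial_derive (S i) j f x y) (partial_derive i (S j) f x y).
Proof.
intros Hij Hf.
(* [partial_derive] differentiates in [y] first, so a further derivative in [y] has to be commuted
   with the [i] derivatives in [x]. *)
assert (Ey : Derive (fun w => partial_derive i j f x w) y
             = partial_derive i (S j) f x y).
{ apply Derive_partial_derive.
  apply locally_2d_impl with (2 := Hf), locally_2d_forall.
  intros s w; apply ex_diff_n_m; lia. }
rewrite <- Ey.
apply filterdiff_differentiable_pt_lim.
eapply filterdiff_ext_lin.
- apply (is_derive_filterdiff (partial_derive i j f) x y
           (partial_derive (S i) j f)).
  + apply locally_2d_locally with
      (P := fun s w => is_derive (fun r => partial_derive i j f r w) s
                         (partial_derive (S i) j f s w)).
    apply locally_2d_impl with (2 := Hf), locally_2d_forall; intros s w Hsw.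
    apply Derive_correct, ex_diff_n_ex_deriv_inf_1 with n; assumption.
  + apply Derive_correct, ex_diff_n_ex_deriv_inf_2 with n; [assumption |].
    now apply locally_2d_singleton.
  + apply continuity_2d_pt_filterlim.
    apply ex_diff_n_continuity_inf_1 with n; [assumption |].
    now apply locally_2d_singleton.
- intros [s w]; reflexivity.
Qed.

Lemma partial_derive_continuity (f : R -> R -> R) (n i j : nat) (x y : R) :
  (i + j <= n)%nat -> ex_diff_n f n x y ->
  continuity_2d_pt (partial_derive i j f) x y.
Proof.
intros Hij Hf; pose proof (ex_diff_n_deriv n i j Hij f x y Hf) as H.
destruct (n - (i + j))%nat; apply H.
Qed.

Lemma disk_open (cx cy r x y : R) :
  disk cx cy r x y -> locally_2d (disk cx cy r) x y.
Proof.
intros H; apply locally_2d_locally.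
apply (open_comp (fun w : R * R => (fst w - cx) ^ 2 + (snd w - cy) ^ 2)
                 (fun s => s < r ^ 2)); [| apply open_lt | exact H].
intros w _; simpl.
apply (continuous_plus (fun w : R * R => (fst w - cx) * ((fst w - cx) * 1))
         (fun w => (snd w - cy) * ((snd w - cy) * 1)));
  apply (continuous_comp _ (fun s => s * (s * 1)));
  try (apply (ex_derive_continuous (fun s => s * (s * 1))); auto_derive; easy).
- apply (continuous_comp fst (fun s => s - cx)); [apply continuous_fst |].
  apply (ex_derive_continuous (fun s => s - cx)); auto_derive; easy.
- apply (continuous_comp snd (fun s => s - cy)); [apply continuous_snd |].
  apply (ex_derive_continuous (fun s => s - cy)); auto_derive; easy.
Qed.

(** * Iterated derivatives along a circular motion *)

(** [k]-th derivative along a circle, for [k <= 4], of a function whose partial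
    derivative of order [(i, j)] has the value [F i j] at a point where the
    velocity is [(p, q)]. *)
Definition circle_derivative (F : nat -> nat -> R) (p q : R) (k : nat) : R :=
  let F_x := F 1%nat 0%nat in
  let F_y := F 0%nat 1%nat in
  let F_xx := F 2%nat 0%nat in
  let F_xy := F 1%nat 1%nat in
  let F_yy := F 0%nat 2%nat in
  let F_xxx := F 3%nat 0%nat in
  let F_xxy := F 2%nat 1%nat in
  let F_xyy := F 1%nat 2%nat in
  let F_yyy := F 0%nat 3%nat in
  let F_xxxx := F 4%nat 0%nat in
  let F_xxxy := F 3%nat 1%nat in
  let F_xxyy := F 2%nat 2%nat in
  let F_xyyy := F 1%nat 3%nat in
  let F_yyyy := F 0%nat 4%nat in
  match k with
  | 0%nat => F 0%nat 0%nat
  | 1%nat =>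
      F_x * p + F_y * q
  | 2%nat =>
      F_xx * p ^ 2 + 2 * F_xy * p * q + F_yy * q ^ 2
      - F_x * q + F_y * p
  | 3%nat =>
      F_xxx * p ^ 3 + 3 * F_xxy * p ^ 2 * q + 3 * F_xyy * p * q ^ 2
      + F_yyy * q ^ 3
      + 3 * (F_yy - F_xx) * p * q + 3 * F_xy * (p ^ 2 - q ^ 2)
      - F_x * p - F_y * q
  | 4%nat =>
      F_xxxx * p ^ 4 + 4 * F_xxxy * p ^ 3 * q
      + 6 * F_xxyy * p ^ 2 * q ^ 2 + 4 * F_xyyy * p * q ^ 3 + F_yyyy * q ^ 4
      - 6 * F_xxx * p ^ 2 * q + 6 * F_xxy * (p ^ 3 - 2 * p * q ^ 2)
      + 6 * F_xyy * (2 * p ^ 2 * q - q ^ 3) + 6 * F_yyy * p * q ^ 2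
      + F_xx * (3 * q ^ 2 - 4 * p ^ 2) - 14 * F_xy * p * q
      + F_yy * (3 * p ^ 2 - 4 * q ^ 2)
      + F_x * q - F_y * p
  | _ => 0
  end.

(** This certifies the table of [circle_derivative]: the product rule, with the given derivatives of
    [p], [q] and [F i j], turns each entry into the next. The bound on [k] keeps [S k] away from the
    default value [0]. *)
Lemma is_derive_circle_derivative (F : nat -> nat -> R -> R) (p q : R -> R)
  (k : nat) (t : R) :
  (k < 4)%nat ->
  is_derive p t (- q t) ->
  is_derive q t (p t) ->
  (forall i j, (i + j <= k)%nat ->
     is_derive (F i j) t (F (S i) j t * p t + F i (S j) t * q t)) ->
  is_derive (fun s => circle_derivative (fun i j => F i j s) (p s) (q s) k) t
    (circle_derivative (fun i j => F i j t) (p t) (q t) (S k)).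
Proof.
intros Hk Hp Hq HF.
assert (Ep : ex_derive p t) by (eexists; exact Hp).
assert (Eq : ex_derive q t) by (eexists; exact Hq).
assert (EF : forall i j, (i + j <= k)%nat -> ex_derive (F i j) t)
  by (intros i j Hij; eexists; exact (HF i j Hij)).
(* The eta-expanded form is the one that [auto_derive] produces. *)
assert (DF : forall i j, (i + j <= k)%nat ->
  Derive (fun s => F i j s) t = F (S i) j t * p t + F i (S j) t * q t)
  by (intros i j Hij; now apply is_derive_unique, HF).
assert (Dp : Derive (fun s => p s) t = - q t) by now apply is_derive_unique.
assert (Dq : Derive (fun s => q s) t = p t) by now apply is_derive_unique.
destruct k as [|[|[|[|k]]]]; [| | | | lia]; simpl circle_derivative;
  auto_derive;
  try (repeat split; first [assumption | apply EF; simpl; lia]);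
  rewrite ?Dp, ?Dq, ?DF by (simpl; lia); ring.
Qed.

(** Serves the top order [k = n], where the partial derivatives of a [C^n] function are continuous
    but the chain rule is no longer available. *)
Lemma continuous_circle_derivative (F : nat -> nat -> R -> R) (p q : R -> R)
  (k : nat) (t : R) :
  continuous p t ->
  continuous q t ->
  (forall i j, (i + j <= k)%nat -> continuous (F i j) t) ->
  continuous (fun s => circle_derivative (fun i j => F i j s) (p s) (q s) k) t.
Proof.
intros Hp Hq HF.
assert (Cp : continuity_pt p t) by now apply continuity_pt_filterlim.
assert (Cq : continuity_pt q t) by now apply continuity_pt_filterlim.
assert (CF : forall i j, (i + j <= k)%nat -> continuity_pt (F i j) t)
  by (intros i j Hij; now apply continuity_pt_filterlim, HF).
apply continuity_pt_filterlim.
destruct k as [|[|[|[|[|k]]]]]; simpl circle_derivative; simpl pow;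
  repeat match goal with
  | |- continuity_pt (fun s => @?g s + @?h s) _ =>
      apply (continuity_pt_plus g h)
  | |- continuity_pt (fun s => @?g s - @?h s) _ =>
      apply (continuity_pt_minus g h)
  | |- continuity_pt (fun s => @?g s * @?h s) _ =>
      apply (continuity_pt_mult g h)
  | |- continuity_pt (fun _ => ?c) _ =>
      apply continuity_pt_const; intros ? ?; reflexivity
  | |- _ => first [exact Cp | exact Cq | apply CF; simpl; lia]
  end.
Qed.

(** * Derivatives of the defect along the conic *)

Definition conic_p (u v t : R) : R := v * cos t + u * sin t.
Definition conic_q (u v t : R) : R := v * sin t - u * cos t.

Definition conic_z_derivative (a b z : R) (k : nat) (t : R) : R :=
  match k with
  | 0%nat => conic_z a b z t
  | 1%nat => a * cos t + b * sin t
  | 2%nat => b * cos t - a * sin t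
  | 3%nat => - a * cos t - b * sin t
  | 4%nat => a * sin t - b * cos t
  | _ => 0
  end.

(** Closed form of the [k]-th derivative of [z(t) - f(x(t), y(t))]. For [k = 0] it is convertible to
    that difference, so [little_o_pow_iff] applies directly to [has_contact]. *)
Definition defect_derivative (f : R -> R -> R) (a b u v x y z : R) (k : nat)
  (t : R) : R :=
  conic_z_derivative a b z k t
  - circle_derivative
      (fun i j => partial_derive i j f (conic_x u v x t) (conic_y u v y t))
      (conic_p u v t) (conic_q u v t) k.

Lemma is_derive_conic_x (u v x t : R) :
  is_derive (conic_x u v x) t (conic_p u v t).
Proof. unfold conic_x, conic_p; auto_derive; [easy | ring]. Qed.

Lemma is_derive_conic_y (u v y t : R) :
  is_derive (conic_y u v y) t (conic_q u v t).
Proof. unfold conic_y, conic_q; auto_derive; [easy | ring]. Qed.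

Lemma is_derive_conic_p (u v t : R) :
  is_derive (conic_p u v) t (- conic_q u v t).
Proof. unfold conic_p, conic_q; auto_derive; [easy | ring]. Qed.

Lemma is_derive_conic_q (u v t : R) :
  is_derive (conic_q u v) t (conic_p u v t).
Proof. unfold conic_p, conic_q; auto_derive; [easy | ring]. Qed.

Lemma is_derive_conic_z_derivative (a b z : R) (k : nat) (t : R) :
  (k < 4)%nat ->
  is_derive (conic_z_derivative a b z k) t (conic_z_derivative a b z (S k) t).
Proof.
intros Hk; destruct k as [|[|[|[|k]]]]; [| | | | lia];
  unfold conic_z_derivative, conic_z; auto_derive; try easy; ring.
Qed.

Lemma ex_derive_conic_z_derivative (a b z : R) (k : nat) (t : R) :
  ex_derive (conic_z_derivative a b z k) t.
Proof.
destruct k as [|[|[|[|[|k]]]]]; unfold conic_z_derivative, conic_z;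
  auto_derive; easy.
Qed.

Lemma is_derive_partial_derive_conic (f : R -> R -> R) (n i j : nat)
  (u v x y t : R) :
  (i + j < n)%nat ->
  locally_2d (ex_diff_n f n) (conic_x u v x t) (conic_y u v y t) ->
  is_derive
    (fun s => partial_derive i j f (conic_x u v x s) (conic_y u v y s)) t
    (partial_derive (S i) j f (conic_x u v x t) (conic_y u v y t)
       * conic_p u v t
     + partial_derive i (S j) f (conic_x u v x t) (conic_y u v y t)
       * conic_q u v t).
Proof.
intros Hij Hf; apply is_derive_Reals, derivable_pt_lim_comp_2d.
- now apply partial_derive_differentiable with n.
- apply is_derive_Reals, is_derive_conic_x.
- apply is_derive_Reals, is_derive_conic_y.
Qed.

Lemma continuous_conic (u v x y t : R) :
  continuous (fun s => (conic_x u v x s, conic_y u v y s)) t.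
Proof.
apply (continuous_comp_2 _ _ (fun s w => (s, w))).
- apply (ex_derive_continuous (conic_x u v x)); eexists.
  apply is_derive_conic_x.
- apply (ex_derive_continuous (conic_y u v y)); eexists.
  apply is_derive_conic_y.
- apply (continuous_ext (fun w => w)); [now intros [] | apply continuous_id].
Qed.

Lemma conic_at_0 (u v x y : R) :
  conic_x u v x 0 = x /\ conic_y u v y 0 = y.
Proof.
unfold conic_x, conic_y; rewrite sin_0, cos_0; split; ring.
Qed.

Lemma has_contact_conic_iff (n : nat) (f : R -> R -> R) (a b u v x y z : R) :
  (n <= 4)%nat ->
  locally_2d (ex_diff_n f n) x y ->
  has_contact n f (conic_x u v x) (conic_y u v y) (conic_z a b z) <->
  forall k, (k <= n)%nat -> defect_derivative f a b u v x y z k 0 = 0.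
Proof.
intros Hn Hf.
destruct (conic_at_0 u v x y) as [X0 Y0].
apply (little_o_pow_iff n (defect_derivative f a b u v x y z)).
- intros k Hk.
  (* The chain rule at a time [t] near [0] needs regularity of [f] around the point reached at time
     [t]. Hence the nested neighbourhoods, pulled back by continuity of the curve. *)
  apply locally_2d_locally, locally_locally in Hf.
  rewrite <- X0, <- Y0 in Hf.
  pose proof (continuous_conic u v x y 0 _ Hf) as Hf'.
  unfold filtermap in Hf'.
  apply filter_imp with (2 := Hf'); intros t Ht.
  apply (is_derive_minus (conic_z_derivative a b z k)).
  + apply is_derive_conic_z_derivative; lia.
  + apply (is_derive_circle_derivative
      (fun i j s => partial_derive i j f (conic_x u v x s) (conic_y u v y s))
      (conic_p u v) (conic_q u v)).
    * lia.
    * apply is_derive_conic_p.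
    * apply is_derive_conic_q.
    * intros i j Hij; apply is_derive_partial_derive_conic with n; [lia |].
      apply locally_2d_locally; exact Ht.
- apply locally_2d_singleton in Hf.
  apply (continuous_minus (conic_z_derivative a b z n)).
  + apply (ex_derive_continuous (conic_z_derivative a b z n)).
    apply ex_derive_conic_z_derivative.
  + apply (continuous_circle_derivative
      (fun i j s => partial_derive i j f (conic_x u v x s) (conic_y u v y s))
      (conic_p u v) (conic_q u v)).
    * apply (ex_derive_continuous (conic_p u v)); eexists.
      apply is_derive_conic_p.
    * apply (ex_derive_continuous (conic_q u v)); eexists.
      apply is_derive_conic_q.
    * intros i j Hij.
      apply (continuous_comp (fun s => (conic_x u v x s, conic_y u v y s))
               (fun w => partial_derive i j f (fst w) (snd w))).
      -- apply continuous_conic.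
      -- rewrite X0, Y0; apply continuity_2d_pt_filterlim.
         now apply partial_derive_continuity with n.
Qed.

(** * The contact equations of orders two, three and four *)

Theorem proposition11 :
  forall (f : R -> R -> R) (cx cy r : R), 0 < r ->
  forall a b u v x y z : R,
  disk cx cy r x y ->
  (u, v) <> (0, 0) ->
  let D := disk cx cy r in
  let contact n :=
    has_contact n f (conic_x u v x) (conic_y u v y) (conic_z a b z) in
  let f_x := partial_derive 1 0 f x y in
  let f_y := partial_derive 0 1 f x y in
  let f_xx := partial_derive 2 0 f x y in
  let f_xy := partial_derive 1 1 f x y in
  let f_yy := partial_derive 0 2 f x y in
  let f_xxx := partial_derive 3 0 f x y in
  let f_xxy := partial_derive 2 1 f x y in
  let f_xyy := partial_derive 1 2 f x y in
  let f_yyy := partial_derive 0 3 f x y in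
  let f_xxxx := partial_derive 4 0 f x y in
  let f_xxxy := partial_derive 3 1 f x y in
  let f_xxyy := partial_derive 2 2 f x y in
  let f_xyyy := partial_derive 1 3 f x y in
  let f_yyyy := partial_derive 0 4 f x y in
  let equations2 :=
    z = f x y /\
    a = f_x * v - f_y * u /\
    b = f_x * u + f_y * v
        + f_xx * v ^ 2 - 2 * f_xy * u * v + f_yy * u ^ 2 in
  let equation3 :=
    f_xxx * v ^ 3 - 3 * f_xxy * v ^ 2 * u + 3 * f_xyy * v * u ^ 2
    - f_yyy * u ^ 3
    + 3 * (f_xx - f_yy) * u * v + 3 * f_xy * (v ^ 2 - u ^ 2) = 0 in
  let equation4 :=
    f_xxxx * v ^ 4 - 4 * f_xxxy * v ^ 3 * u + 6 * f_xxyy * v ^ 2 * u ^ 2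
    - 4 * f_xyyy * v * u ^ 3 + f_yyyy * u ^ 4
    + 6 * u * v ^ 2 * f_xxx + 6 * v * (v ^ 2 - 2 * u ^ 2) * f_xxy
    + 6 * u * (u ^ 2 - 2 * v ^ 2) * f_xyy + 6 * u ^ 2 * v * f_yyy
    + 3 * (u ^ 2 - v ^ 2) * (f_xx - f_yy) + 12 * u * v * f_xy = 0 in
  (class_Cn_on D 2 f -> (contact 2%nat <-> equations2)) /\
  (class_Cn_on D 3 f -> (contact 3%nat <-> equations2 /\ equation3)) /\
  (class_Cn_on D 4 f ->
     (contact 4%nat <-> equations2 /\ equation3 /\ equation4)).
Proof.
intros f cx cy r _ a b u v x y z Hxy _; cbv zeta.
assert (C : forall n, (n <= 4)%nat -> class_Cn_on (disk cx cy r) n f ->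
  has_contact n f (conic_x u v x) (conic_y u v y) (conic_z a b z) <->
  forall k, (k <= n)%nat -> defect_derivative f a b u v x y z k 0 = 0).
{ intros n Hn Hf; apply has_contact_conic_iff; [exact Hn |].
  apply locally_2d_impl with (2 := disk_open cx cy r x y Hxy).
  apply locally_2d_forall; exact Hf. }
(* At [t = 0] the projected point is [(x, y)] and its velocity is [(v, - u)]. *)
assert (V : forall k, defect_derivative f a b u v x y z k 0 =
  conic_z_derivative a b z k 0
  - circle_derivative (fun i j => partial_derive i j f x y) v (- u) k).
{ intros k; unfold defect_derivative, conic_p, conic_q.
  destruct (conic_at_0 u v x y) as [-> ->]; rewrite sin_0, cos_0.
  do 2 f_equal; ring. }
pose proof (V 0%nat) as V0; pose proof (V 1%nat) as V1.
pose proof (V 2%nat) as V2; pose proof (V 3%nat) as V3.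
pose proof (V 4%nat) as V4; clear V.
unfold conic_z_derivative, conic_z in V0, V1, V2, V3, V4.
rewrite sin_0, cos_0 in V0, V1, V2, V3, V4.
unfold circle_derivative in V0, V1, V2, V3, V4.
change (partial_derive 0 0 f x y) with (f x y) in V0.
(* The defects of order [0], [1], [2] vanish exactly under [equations2]. The defect of order [3] is
   minus the left side of [equation3] minus the defect of order [1]; that of order [4] is minus the
   left side of [equation4] minus the defect of order [2]. All cases are therefore linear in the
   monomials, within reach of [lra]. *)
split; [| split]; intros Hf; rewrite C by (exact Hf || lia); split.
- intros H; rewrite (H 0%nat) in V0 by lia; rewrite (H 1%nat) in V1 by lia.
  rewrite (H 2%nat) in V2 by lia; repeat split; lra.
- intros H [|[|[|k]]] Hk; [rewrite V0 | rewrite V1 | rewrite V2 | lia]; lra.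
- intros H; rewrite (H 0%nat) in V0 by lia; rewrite (H 1%nat) in V1 by lia.
  rewrite (H 2%nat) in V2 by lia; rewrite (H 3%nat) in V3 by lia.
  repeat split; lra.
- intros H [|[|[|[|k]]]] Hk;
    [rewrite V0 | rewrite V1 | rewrite V2 | rewrite V3 | lia]; lra.
- intros H; rewrite (H 0%nat) in V0 by lia; rewrite (H 1%nat) in V1 by lia.
  rewrite (H 2%nat) in V2 by lia; rewrite (H 3%nat) in V3 by lia.
  rewrite (H 4%nat) in V4 by lia; repeat split; lra.
- intros H [|[|[|[|[|k]]]]] Hk;
    [rewrite V0 | rewrite V1 | rewrite V2 | rewrite V3 | rewrite V4 | lia]; lra.
Qed.
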